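(* Let $n \geq 1$ and let $f : \{0,1\}^n \to \{0,1\}$ be a non-constant symmetric Boolean function. Let $0 \leq \ell_0(f) \leq \ell_1(f) \leq n$ be the end points of a largest interval of Hamming weights on which $f$ is constant, i.e. integers such that $f$ takes the same value on all inputs of Hamming weight in $\{\ell_0(f), \ell_0(f)+1, \dots, \ell_1(f)\}$ and $\ell_1(f) - \ell_0(f)$ is maximal among all such intervals. Then \[ \mathsf{InstC}(f) = \frac{n}{\mathsf{C}_{\mathsf{min}}(f)} = \frac{n}{\ell_0(f) + n - \ell_1(f)}. \]
   Context: A function $f:\{0,1\}^n\to\{0,1\}$ is symmetric if $f(x)=f(\sigma(x))$ for every permutation $\sigma$ of the coordinates, equivalently $f(x)$ depends only on the Hamming weight $|x|$ (number of 1s). A deterministic decision tree is a rooted binary tree whose internal nodes are labeled by variables $x_i$, whose two outgoing edges at each internal node are labeled $0$ and $1$, and whose leaves are labeled by values in $\{0,1\}$; on input $x$ it follows the path from the root determined by the values of the queried variables and outputs the leaf label. It computes $f$ if its output equals $f(x)$ for all $x$. For a tree $\mathcal{T}$, $\mathcal{T}(x)$ denotes the number of queries (internal nodes on the path) made on input $x$. A certificate for $x$ w.r.t. $f$ is a set $S\subseteq[n]$ such that $f(y)=f(x)$ for all $y$ with $y_S=x_S$; $\mathsf{C}(f,x)$ is the minimum size of such a set, and $\mathsf{C}_{\mathsf{min}}(f)=\min_x \mathsf{C}(f,x)$. The instance complexity is $\mathsf{InstC}(f)=\min_{\mathcal{T}}\max_{x\in\{0,1\}^n}\frac{\mathcal{T}(x)}{\mathsf{C}(f,x)}$,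 the minimum over all decision trees $\mathcal{T}$ computing $f$. *)

(* Defs.v *)
From mathcomp Require Import all_boot all_order all_algebra all_fingroup.
From mathcomp Require Import boolp classical_sets.

Set Implicit Arguments.
Unset Strict Implicit.
Unset Printing Implicit Defensive.

Import Order.TTheory GRing.Theory Num.Theory.
Local Open Scope ring_scope.

Definition cube (n : nat) := {ffun 'I_n -> bool}.

Definition weight n (x : cube n) : nat := #|[pred i | x i]|.

Definition symmetric_fun n (f : cube n -> bool) : Prop :=
  forall (s : {perm 'I_n}) (x : cube n), f [ffun i => x (s i)] = f x.

Definition constant_fun n (f : cube n -> bool) : Prop :=
  forall x y : cube n, f x = f y.

Inductive dtree (n : nat) : Type :=
| Leaf of bool
| Query (i : 'I_n) (t0 t1 : dtree n).

Arguments Leaf {n}.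

Fixpoint output n (T : dtree n) (x : cube n) : bool :=
  match T with
  | Leaf b => b
  | Query i t0 t1 => if x i then output t1 x else output t0 x
  end.

Fixpoint queries n (T : dtree n) (x : cube n) : nat :=
  match T with
  | Leaf _ => 0
  | Query i t0 t1 => (if x i then queries t1 x else queries t0 x).+1
  end.

Definition computes n (T : dtree n) (f : cube n -> bool) : Prop :=
  forall x, output T x = f x.

Definition certificate n (f : cube n -> bool) (x : cube n) (S : {set 'I_n}) :=
  [forall y : cube n, [forall i in S, y i == x i] ==> (f y == f x)].

(* The full set [set: 'I_n] is always a certificate, so the minima below range *)
(* over nonempty families.                                                     *)
Definition C n (f : cube n -> bool) (x : cube n) : nat :=
  #|[arg min_(S < [set: 'I_n] | certificate f x S) #|S|]|.

Definition Cmin n (f : cube n -> bool) : nat :=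
  C f [arg min_(x < ([ffun=> false] : cube n)) C f x].

(* The ratios are nonnegative, so starting the iterated maximum at 0 is         *)
(* harmless. C f x > 0 whenever f is not constant.                              *)
Definition max_ratio n (f : cube n -> bool) (T : dtree n) : rat :=
  \big[Num.max/0]_(x : cube n) ((queries T x)%:R / (C f x)%:R).

Definition is_min_ratio n (f : cube n -> bool) (r : rat) : Prop :=
  (exists2 T : dtree n, computes T f & max_ratio f T = r) /\
  (forall T : dtree n, computes T f -> r <= max_ratio f T).

(* There are infinitely many trees computing f; InstCP shows that the minimum   *)
(* nevertheless exists, so the default value 0 of xget is never used.           *)
Definition InstC n (f : cube n -> bool) : rat := xget 0 (is_min_ratio f).

Definition constant_on_weights n (f : cube n -> bool) (a b : nat) : Prop :=
  forall x y : cube n, (a <= weight x <= b)%N -> (a <= weight y <= b)%N ->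
    f x = f y.

Definition largest_constant_interval n (f : cube n -> bool) (a b : nat) : Prop :=
  [/\ (a <= b <= n)%N, constant_on_weights f a b &
      forall a' b' : nat, (a' <= b' <= n)%N -> constant_on_weights f a' b' ->
        (b' - a' <= b - a)%N].

Section WellDefined.
Variables (n : nat) (f : cube n -> bool).

Lemma certificateT x : certificate f x [set: 'I_n].
Proof.
apply/forallP => y; apply/implyP => /forallP yx; apply/eqP; congr f.
by apply/ffunP => i; apply/eqP; move/implyP: (yx i); apply; rewrite inE.
Qed.

Lemma CP x : exists S, [/\ certificate f x S, #|S| = C f x &
  forall S', certificate f x S' -> (C f x <= #|S'|)%N].
Proof.
rewrite /C; case: arg_minnP => [|S cS minS]; first exact: certificateT.
by exists S.
Qed.

Lemma CminP : (exists x, C f x = Cmin f) /\ forall x, (Cmin f <= C f x)%N.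
Proof.
rewrite /Cmin; case: arg_minnP => // x _ minx.
by split; [exists x | move=> y; exact: minx].
Qed.

Lemma C_le x : (C f x <= n)%N.
Proof. by have [S [_ <- _]] := CP x; rewrite -[leqRHS]card_ord max_card. Qed.

Lemma C_gt0 x : ~ constant_fun f -> (0 < C f x)%N.
Proof.
move=> ncf; rewrite lt0n; apply/eqP => C0; apply: ncf => y z.
have [S [cS cardS _]] := CP x; move: cardS; rewrite C0 => /eqP.
rewrite cards_eq0 => /eqP S0; rewrite S0 in cS.
have fx w : f w = f x.
  move/forallP/(_ w)/implyP: cS => /(_ _)/eqP; apply.
  by apply/forallP => i; rewrite inE.
by rewrite !fx.
Qed.

Fixpoint full_tree (s : seq 'I_n) (x : cube n) : dtree n :=
  if s is i :: s' then
    Query i (full_tree s' [ffun j => if j == i then false else x j])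
            (full_tree s' [ffun j => if j == i then true else x j])
  else Leaf (f x).

Lemma full_treeP s x y :
  output (full_tree s x) y = f [ffun i => if i \in s then y i else x i].
Proof.
elim: s x => [|i s IHs] x /=.
  by congr f; apply/ffunP => j; rewrite ffunE.
case yi: (y i); rewrite IHs; congr f; apply/ffunP => j; rewrite !ffunE inE;
  by case: eqVneq => [->|]; case: (_ \in s).
Qed.

Lemma computes_ex : exists T, computes T f.
Proof.
exists (full_tree (enum 'I_n) [ffun=> false]) => x; rewrite full_treeP.
by congr f; apply/ffunP => j; rewrite ffunE mem_enum.
Qed.

Lemma max_ratio_nat T : exists m : nat, max_ratio f T * n`!%:R = m%:R.
Proof.
rewrite /max_ratio; elim/big_ind: _ => [|r s [a ra] [b sb]|x _].
- by exists 0%N; rewrite mul0r.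
- by case: (leP r s) => _; [exists b | exists a].
have [->|Cx] := posnP (C f x); first by exists 0%N; rewrite invr0 mulr0 mul0r.
have /dvdnP[k ->] : (C f x %| n`!)%N by rewrite dvdn_fact // Cx C_le.
exists (queries T x * k)%N.
by rewrite !natrM mulrCA !mulrA mulfVK ?pnatr_eq0 -?lt0n // mulrC.
Qed.

Lemma InstCP : is_min_ratio f (InstC f).
Proof.
suff [r rP] : exists r, is_min_ratio f r by exact: (xgetI _ rP).
pose P m := `[< exists2 T, computes T f & max_ratio f T * n`!%:R = m%:R >].
have exP : exists m, P m.
  have [T Tf] := computes_ex; have [m mE] := max_ratio_nat T.
  by exists m; apply/asboolP; exists T.
case: (ex_minnP exP) => m /asboolP[T Tf TE] minm.
exists (max_ratio f T); split; first by exists T.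
move=> T' T'f; have [m' E'] := max_ratio_nat T'.
rewrite -(ler_pM2r (x := n`!%:R)) ?ltr0n ?fact_gt0 // TE E' ler_nat.
by apply: minm; apply/asboolP; exists T'.
Qed.

End WellDefined.

(* Main.v *)
(** A certificate for [x] that reads [a] ones and [b] zeros fixes [f] exactly on
    the weights between [a] and [n - b], so the cheapest certificates come from
    the largest constant interval [l0 .. l1] and [Cmin f = l0 + n - l1].
    Reading all [n] bits has ratio at most [n / Cmin f].  Conversely, as [f] is
    not constant, it changes value at one end of the interval, between weights
    [w] and [w + 1] say.  An adversary that answers [w] ones and [n - 1 - w]
    zeros to the first [n - 1] distinct queries forces every tree to read all
    [n] bits, and the last answer can be chosen so that the weight of the input
    lies in [l0 .. l1], where the certificate complexity is [Cmin f]. *)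

Require Import Defs.
From mathcomp Require Import all_boot all_order all_algebra.
From mathcomp Require Import all_fingroup zify.

Set Implicit Arguments.
Unset Strict Implicit.
Unset Printing Implicit Defensive.

Import Order.TTheory GRing.Theory Num.Theory.
Local Open Scope ring_scope.

(** * Inputs as sets of ones, and permutations between inputs of equal weight *)

(** Serves to pick inputs of prescribed weight with forced ones on [A] and forced zeros outside
    [U]. *)
Lemma subset_interpolate (T : finType) (A U : {set T}) k :
  A \subset U -> (#|A| <= k <= #|U|)%N ->
  exists X : {set T}, [/\ A \subset X, X \subset U & #|X| = k].
Proof.
move=> AU; case/andP=> Ak; have [d ->] : exists d, k = (#|A| + d)%N.
  by exists (k - #|A|)%N; rewrite subnKC.
elim: d {k Ak} => [|d IHd] le_U; first by exists A; rewrite addn0.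
have [|X [AX XU cX]] := IHd; first lia.
have /properP[_ [i iU iX]] : X \proper U.
  by rewrite properEcard XU; lia.
exists (i |: X); split.
- exact: subset_trans AX (subsetUr _ _).
- by rewrite subUset sub1set iU.
- by rewrite cardsU1 iX cX; lia.
Qed.

Section Cube.
Variable n : nat.

Definition ones (x : cube n) : {set 'I_n} := [set i | x i].

Definition cube_of (X : {set 'I_n}) : cube n := [ffun i => i \in X].

Lemma cube_ofE X i : cube_of X i = (i \in X).
Proof. by rewrite ffunE. Qed.

Lemma card_ones x : #|ones x| = weight x.
Proof. exact: cardsE. Qed.

Lemma weight_cube_of X : weight (cube_of X) = #|X|.
Proof. by apply: eq_card => i; rewrite inE ffunE. Qed.

Lemma weight_le (x : cube n) : (weight x <= n)%N.
Proof. by rewrite -[leqRHS]card_ord max_card. Qed.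

Lemma cube_of_weight k : (k <= n)%N -> exists x : cube n, weight x = k.
Proof.
move=> kn; have [||X [_ _ <-]] := @subset_interpolate _ (set0 : {set 'I_n}) setT k.
- exact: sub0set.
- by rewrite cards0 cardsT card_ord.
- by exists (cube_of X); rewrite weight_cube_of.
Qed.

(** Read as tuples of booleans, [x] and [y] contain equally many [true] and equally many [false], so
    one tuple permutes the other. *)
Lemma eq_weight_perm (x y : cube n) : weight x = weight y ->
  exists s : {perm 'I_n}, y = [ffun i => x (s i)].
Proof.
move=> exy; pose t (z : cube n) := [tuple z i | i < n].
have countE z : count_mem true (t z) = weight z.
  rewrite /weight cardE -size_filter /t /= filter_map size_map enumT.
  by rewrite /enum_mem; congr size; apply: eq_filter => i /=; rewrite eqb_id.
have /tuple_permP[s es] : perm_eq (t y) (t x).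
  apply/allP => b _; apply/eqP; case: b; first by rewrite /= !countE.
  have countF z : count_mem false (t z) = (n - weight z)%N.
    rewrite -countE -[X in (X - _)%N](size_tuple (t z)).
    rewrite -(count_predC (pred1 true) (t z)) addKn.
    by apply: eq_count; case.
  by rewrite /= !countF exy.
exists s; apply/ffunP => i; rewrite ffunE.
have /(congr1 (fun u : n.-tuple bool => tnth u i)) :
  t y = [tuple tnth (t x) (s j) | j < n] by apply: val_inj.
by rewrite !tnth_mktuple.
Qed.

(** The pair [A], [B] records the queries answered so far by 1 and by 0. *)
Lemma adversary (g : nat -> bool) (w : nat) (b : bool) (T : dtree n)
    (A B : {set 'I_n}) :
  g w != g w.+1 -> [disjoint A & B] -> (#|A| <= w)%N -> (#|B| + w < n)%N ->
  (forall X : {set 'I_n}, A \subset X -> X \subset ~: B ->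
    output T (cube_of X) = g #|X|) ->
  exists X : {set 'I_n}, [/\ A \subset X, X \subset ~: B, #|X| = (w + b)%N &
    (n <= queries T (cube_of X) + #|A| + #|B|)%N].
Proof.
move=> gw; have cC (D : {set 'I_n}) : (#|D| + #|~: D| = n)%N.
  by rewrite cardsC card_ord.
elim: T A B => [c|i t0 IH0 t1 IH1] A B dAB Aw Bw TE.
  (* At a leaf the answers still allow inputs of weight [w] and of weight [w.+1]; a single label
     cannot suit both. *)
  have AB : A \subset ~: B by rewrite -disjoints_subset.
  have cB := cC B.
  have [|X [AX XB cX]] := @subset_interpolate _ A (~: B) w AB; first lia.
  have [|Y [AY YB cY]] := @subset_interpolate _ A (~: B) w.+1 AB; first lia.
  by move: gw; rewrite -cY -{1}cX -!TE ?eqxx.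
(* A repeated query gets its earlier answer, leaving [A] and [B] unchanged. *)
have [iA|iA] := boolP (i \in A).
  have [X AX XB|X [AX XB cX qX]] := IH1 A B dAB Aw Bw.
    by rewrite -TE //= cube_ofE (subsetP AX).
  exists X; split=> //=; by rewrite cube_ofE (subsetP AX) //= !addSn leqW.
have [iB|iB] := boolP (i \in B).
  have iX (X : {set 'I_n}) : X \subset ~: B -> (i \in X) = false.
    by move=> XB; apply/negP => /(subsetP XB); rewrite inE iB.
  have [X AX XB|X [AX XB cX qX]] := IH0 A B dAB Aw Bw.
    by rewrite -TE //= cube_ofE iX.
  exists X; split=> //=; by rewrite cube_ofE iX //= !addSn leqW.
have cA1 : #|i |: A| = #|A|.+1 by rewrite cardsU1 iA.
have cB1 : #|i |: B| = #|B|.+1 by rewrite cardsU1 iB.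
(* A fresh query is answered 1 until [w] ones are given, then 0 as long as a free index remains
   afterwards. *)
have [ltA|geA] := ltnP #|A| w.
  have [||//|X|X [AX XB cX qX]] := IH1 (i |: A) B.
  - by rewrite disjoints_subset subUset sub1set inE iB -disjoints_subset.
  - by rewrite cA1.
  - rewrite subUset sub1set => /andP[iX AX] XB.
    by rewrite -TE //= cube_ofE iX.
  move: AX; rewrite subUset sub1set => /andP[iX AX].
  exists X; split=> //=; by rewrite cube_ofE iX /= addSnnS -cA1.
have [ltB|geB] := ltnP (#|B| + w).+1 n.
  have iX (X : {set 'I_n}) : X \subset ~: (i |: B) ->
    (i \in X) = false /\ X \subset ~: B.
    rewrite setCU subsetI => /andP[Xi ->]; split=> //.
    by apply/negP => /(subsetP Xi); rewrite !inE eqxx.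
  have [|//||X AX XB|X [AX XB cX qX]] := IH0 A (i |: B).
  - by rewrite disjoint_sym disjoints_subset subUset sub1set inE iA
      -disjoints_subset disjoint_sym.
  - by rewrite cB1.
  - by have [iX0 XB0] := iX X XB; rewrite -TE //= cube_ofE iX0.
  have [iX0 XB0] := iX X XB.
  exists X; split=> //=; by rewrite cube_ofE iX0 /= !addSn -addnS -cB1.
(* Now [#|A| + #|B| = n - 1], so [i] is the only free index: this query completes the count to [n],
   and [b] decides its answer. *)
have AB : A \subset ~: B by rewrite -disjoints_subset.
have cAw : #|A| = w by apply/eqP; rewrite eqn_leq Aw geA.
exists (if b then i |: A else A); split.
- by case: (b) => //; exact: subsetUr.
- by case: (b) => //; rewrite subUset sub1set inE iB.
- by case: (b); rewrite ?cA1 cAw ?addn1 ?addn0.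
- rewrite /= cAw -addnA addSn (leq_trans geB) // ltnS.
  by rewrite [(#|B| + w)%N]addnC leq_addl.
Qed.

End Cube.

Lemma queries_full_tree n (f : cube n -> bool) s x y :
  queries (full_tree f s x) y = size s.
Proof. by elim: s x => //= i s IHs x; rewrite !IHs if_same. Qed.

(** * Certificates of symmetric functions *)

Section Symmetric.
Variables (n : nat) (f : cube n -> bool).
Hypothesis f_sym : symmetric_fun f.

Lemma symmetric_eq_weight x y : weight x = weight y -> f x = f y.
Proof. by case/eq_weight_perm => s ->; rewrite f_sym. Qed.

Definition weight_fun k : bool := f [ffun i : 'I_n => (i < k)%N].

Lemma weight_funE x : f x = weight_fun (weight x).
Proof.
rewrite /weight_fun; apply: symmetric_eq_weight; symmetry.
have := weight_le x; move: (weight x) => k kn.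
rewrite /weight -sum1_card (eq_bigl (fun i : 'I_n => (i < k)%N)); last first.
  by move=> i; rewrite inE ffunE.
by rewrite -(big_ord_widen n (fun=> 1%N) kn) sum1_card card_ord.
Qed.

Lemma queries_ge_n T w (b : bool) : computes T f -> (w < n)%N ->
  weight_fun w != weight_fun w.+1 ->
  exists2 x : cube n, weight x = (w + b)%N & (n <= queries T x)%N.
Proof.
move=> Tf wn gw.
have [||||X [_ _ cX]] := @adversary n weight_fun w b T set0 set0 gw.
- by rewrite -setI_eq0 setI0.
- by rewrite cards0.
- by rewrite cards0.
- by move=> X _ _; rewrite Tf weight_funE weight_cube_of.
rewrite cards0 !addn0 => qX.
by exists (cube_of X); rewrite ?weight_cube_of.
Qed.

(** Each weight in this range is attained by an input that agrees with [x] on [S]; symmetry carries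
    its value to all inputs of that weight. *)
Lemma certificate_constant x (S : {set 'I_n}) : certificate f x S ->
  constant_on_weights f #|ones x :&: S| (n - #|S :\: ones x|).
Proof.
move=> /forallP cS.
suff fE y : (#|ones x :&: S| <= weight y <= n - #|S :\: ones x|)%N -> f y = f x.
  by move=> y z hy hz; rewrite !fE.
move=> hy.
have [||X [AX XB cX]] := @subset_interpolate _
    (ones x :&: S) (~: (S :\: ones x)) (weight y).
- by apply/subsetP => i; rewrite !inE => /andP[->].
- by have := cardsC (S :\: ones x); rewrite card_ord; lia.
rewrite (@symmetric_eq_weight y (cube_of X)) ?weight_cube_of ?cX //.
have /implyP/(_ _)/eqP -> // := cS (cube_of X).
apply/forallP => i; apply/implyP => iS; rewrite cube_ofE.
case xi: (x i).
  by rewrite (subsetP AX) // !inE xi.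
by apply/eqP/negP => /(subsetP XB); rewrite !inE xi iS.
Qed.

(** Fixing [a] ones and [n - b] zeros of [x] keeps the weight of every agreeing input between [a]
    and [b]. *)
Lemma C_le_interval a b x : constant_on_weights f a b -> (b <= n)%N ->
  (a <= weight x <= b)%N -> (C f x <= a + (n - b))%N.
Proof.
move=> fab bn hx.
have cX : (#|ones x| + #|~: ones x| = n)%N by rewrite cardsC card_ord.
rewrite card_ones in cX.
have [|A [_ AX cA]] := @subset_interpolate _ set0 (ones x) a (sub0set _).
  by rewrite cards0 card_ones; lia.
have [|B [_ BX cB]] := @subset_interpolate _ set0 (~: ones x) (n - b) (sub0set _).
  by rewrite cards0; lia.
have [_ [_ _ minC]] := CP f x.
apply: leq_trans (minC (A :|: B) _) _; last first.
  by rewrite -cA -cB; exact: leq_card_setU.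
apply/forallP => y; apply/implyP => /forallP yx; apply/eqP.
apply: fab => //.
have yE i : i \in A :|: B -> y i = x i by move=> iAB; have /implyP/(_ iAB)/eqP := yx i.
have Ay : A \subset ones y.
  apply/subsetP => i iA; have := subsetP AX i iA.
  by rewrite !inE yE // inE iA.
have By : B \subset ~: ones y.
  apply/subsetP => i iB; have := subsetP BX i iB.
  by rewrite !inE yE // inE iB orbT.
have := subset_leq_card Ay; have := subset_leq_card By.
have := cardsC (ones y); rewrite card_ord card_ones cA cB; lia.
Qed.

(** * The largest constant interval and the jump at its ends *)

Variables l0 l1 : nat.
Hypothesis hl : largest_constant_interval f l0 l1.

Lemma C_ge_largest x : (l0 + (n - l1) <= C f x)%N.
Proof.
have [ll _ maxl] := hl.
have [S [cS <- _]] := CP f x.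
have cE : #|S| = (#|ones x :&: S| + #|S :\: ones x|)%N.
  by rewrite -(cardsID (ones x) S) setIC.
(* These bounds show that the interval given by the certificate is nonempty, as [maxl] requires. *)
have cX : (#|ones x| + #|~: ones x| = n)%N by rewrite cardsC card_ord.
have le1 : (#|ones x :&: S| <= #|ones x|)%N by rewrite subset_leq_card ?subsetIl.
have le0 : (#|S :\: ones x| <= #|~: ones x|)%N.
  by rewrite subset_leq_card // setDE subsetIr.
have := maxl _ _ _ (certificate_constant cS); lia.
Qed.

Lemma C_largest x : (l0 <= weight x <= l1)%N -> C f x = (l0 + (n - l1))%N.
Proof.
move=> hx; have [/andP[_ l1n] fl _] := hl.
by apply/eqP; rewrite eqn_leq C_le_interval // C_ge_largest.
Qed.

Lemma Cmin_largest : Cmin f = (l0 + (n - l1))%N.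
Proof.
have [/andP[ll l1n] _ _] := hl.
have [[x xE] minC] := CminP f.
have [y yE] := cube_of_weight (leq_trans ll l1n).
apply/eqP; rewrite eqn_leq -{2}xE C_ge_largest andbT -(C_largest (x := y)) //.
by rewrite yE leqnn.
Qed.

Lemma weight_fun_interval k : (l0 <= k <= l1)%N -> weight_fun k = weight_fun l0.
Proof.
move=> hk; have [ll fl _] := hl.
have [x xk] : exists x : cube n, weight x = k by apply: cube_of_weight; lia.
have [y yk] : exists y : cube n, weight y = l0 by apply: cube_of_weight; lia.
by rewrite -xk -yk -!weight_funE; apply: fl; lia.
Qed.

(** Otherwise the interval could be extended by one weight, against maximality. *)
Lemma weight_fun_right : (l1 < n)%N -> weight_fun l1 != weight_fun l1.+1.
Proof.
move=> l1n; have [ll _ maxl] := hl; apply/eqP => e.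
suff /maxl : constant_on_weights f l0 l1.+1 by lia.
suff gE k : (l0 <= k <= l1.+1)%N -> weight_fun k = weight_fun l0.
  by move=> x y hx hy; rewrite !weight_funE !gE.
move=> hk; have [kl|kl] := leqP k l1; first by apply: weight_fun_interval; lia.
have -> : k = l1.+1 by lia.
by rewrite -e; apply: weight_fun_interval; lia.
Qed.

Lemma weight_fun_left : (0 < l0)%N -> weight_fun l0.-1 != weight_fun l0.
Proof.
move=> l0_gt0; have [ll _ maxl] := hl; apply/eqP => e.
suff /maxl : constant_on_weights f l0.-1 l1 by lia.
suff gE k : (l0.-1 <= k <= l1)%N -> weight_fun k = weight_fun l0.
  by move=> x y hx hy; rewrite !weight_funE !gE.
move=> hk; have [kl|kl] := leqP l0 k; first by apply: weight_fun_interval; lia.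
by have -> : k = l0.-1 by lia.
Qed.

(** If [l1 < n], the jump after [l1] with last answer 0 gives weight [l1]. Otherwise [l0 > 0], and
    the jump before [l0] with last answer 1 gives weight [l0]. *)
Lemma hard_input T : ~ constant_fun f -> computes T f ->
  exists2 x : cube n, (l0 <= weight x <= l1)%N & (n <= queries T x)%N.
Proof.
move=> ncf Tf; have [ll fl _] := hl.
have [l1n|l1n] := ltnP l1 n.
  have [x xw qx] := queries_ge_n false Tf l1n (weight_fun_right l1n).
  by exists x => //; rewrite xw; lia.
have [l00|l0_gt0] := posnP l0.
  by case: ncf => x y; apply: fl; rewrite l00 /= (leq_trans (weight_le _)).
have [||x xw qx] := @queries_ge_n T l0.-1 true Tf.
- by lia.
- by rewrite prednK // weight_fun_left.
by exists x => //; rewrite xw /=; lia.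
Qed.

End Symmetric.

Theorem theorem3p4 (n : nat) (hn : (1 <= n)%N) (f : cube n -> bool)
    (f_sym : symmetric_fun f) (f_nconst : ~ constant_fun f)
    (l0 l1 : nat) (hl : largest_constant_interval f l0 l1) :
  InstC f = n%:R / (Cmin f)%:R /\
  (n%:R / (Cmin f)%:R : rat) = n%:R / (l0%:R + n%:R - l1%:R).
Proof.
have CminE := Cmin_largest f_sym hl; have [/andP[_ l1n] _ _] := hl.
(* The truncated difference [n - l1] is a true one because [l1 <= n]. *)
split; last by rewrite CminE natrD natrB // addrA.
have [[x0 x0E] minC] := CminP f.
have Cmin_gt0 : (0 < Cmin f)%N by rewrite -x0E C_gt0.
have [[T Tf TE] minT] := InstCP f.
apply/le_anti/andP; split; last first.
  have [x hx qx] := hard_input f_sym hl f_nconst Tf.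
  rewrite -TE; apply: le_trans (le_bigmax _ _ x).
  by rewrite (C_largest f_sym hl hx) -CminE ler_wpM2r ?invr_ge0 ?ler0n ?ler_nat.
(* The tree that reads all bits; every coordinate of the starting point is overwritten. *)
pose T' := full_tree f (enum 'I_n) [ffun=> false].
have T'f : computes T' f.
  move=> x; rewrite full_treeP.
  by congr f; apply/ffunP => j; rewrite ffunE mem_enum.
apply: le_trans (minT _ T'f) _; apply: bigmax_le => [|x _].
  by rewrite divr_ge0 ?ler0n.
rewrite queries_full_tree size_enum_ord ler_wpM2l ?ler0n //.
by rewrite lef_pV2 ?posrE ?ltr0n ?C_gt0 // ler_nat.
Qed.
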